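(* (1) $\kappa^0(C_l^2)\geqslant 4/9$ for all integers $l\geqslant 5$ with $l\not\equiv 0\pmod 6$, and $\kappa^0(P_l^2)\geqslant 3/8$ for all integers $l\geqslant 7$. (2) Moreover, for each $l\geqslant 5$ with $l\not\equiv 0\pmod 6$ there exist, for arbitrarily large $n$, $n$-vertex $4n/9$-regular oriented graphs containing no copy of $C_l^2$; and for each $l\geqslant 7$ there exist, for arbitrarily large $n$, $n$-vertex $3n/8$-regular oriented graphs containing no copy of $P_l^2$.
   Context: An oriented graph is a digraph without loops, parallel edges, or 2-cycles; it is $d$-regular if every vertex has in-degree $d$ and out-degree $d$. $\delta^0(G)$ is the minimum of all in-degrees and out-degrees of vertices of $G$. $C_l$ is the directed cycle on $l$ vertices and $P_l$ is the directed path on $l$ vertices. For a directed path or cycle $L$, the square $L^2$ is the digraph obtained from $L$ by adding a directed edge from $x$ to $y$ whenever there is a directed path of length at most $2$ from $x$ to $y$ on $L$. For an oriented graph $H$, $g(n,H)$ is the smallest number such that every $n$-vertex oriented graph $G$ with $\delta^0(G)\geqslant g(n,H)$ contains a copy of $H$, and $\kappa^0(H)=\lim_{n\to\infty} g(n,H)/n$. *)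

(* Defs.v *)
From HB Require Import structures.
From mathcomp Require Import all_boot all_order all_algebra.
From mathcomp Require Import boolp classical_sets reals topology normedtype sequences.
Set Implicit Arguments.
Unset Strict Implicit.
Unset Printing Implicit Defensive.
Import Order.TTheory GRing.Theory Num.Theory.
Import numFieldNormedType.Exports.

Local Open Scope nat_scope.

(* A digraph without parallel edges is a relation on a finite vertex type. *)
Definition oriented (T : finType) (e : rel T) : Prop :=
  irreflexive e /\ forall x y, ~~ (e x y && e y x).

Definition outdeg (T : finType) (e : rel T) (x : T) : nat := #|[set y | e x y]|.
Definition indeg (T : finType) (e : rel T) (x : T) : nat := #|[set y | e y x]|.

Definition regular (T : finType) (d : nat) (e : rel T) : Prop :=
  forall x, indeg e x = d /\ outdeg e x = d.

(* The default value #|T| bounds every degree, so it does not affect the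
   minimum when T is nonempty. *)
Definition delta0 (T : finType) (e : rel T) : nat :=
  \big[minn/#|T|]_(x : T) minn (indeg e x) (outdeg e x).

(* Copies are subgraphs, not necessarily induced. *)
Definition contains_copy (T V : finType) (e : rel T) (h : rel V) : Prop :=
  exists2 f : V -> T, injective f & forall x y, h x y -> e (f x) (f y).

Definition dicycle (l : nat) : rel 'I_l := [rel i j | j == ordS i].
Definition dipath (l : nat) : rel 'I_l := [rel i j : 'I_l | j == i.+1 :> nat].

(* The condition x != y excludes the paths of length 0, which would create
   loops. *)
Definition square (T : finType) (e : rel T) : rel T :=
  [rel x y | (x != y) && (e x y || [exists z, e x z && e z y])].

Definition forces (V : finType) (h : rel V) (n m : nat) : Prop :=
  forall e : rel 'I_n, oriented e -> m <= delta0 e -> contains_copy e h.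

Lemma delta0_le_card (T : finType) (e : rel T) : delta0 e <= #|T|.
Proof.
rewrite /delta0; elim/big_rec: _ => // x m _ le_m.
exact: leq_trans (geq_minr _ _) le_m.
Qed.

Lemma forces_ex (V : finType) (h : rel V) (n : nat) :
  exists m, `[< forces h n m >].
Proof.
exists n.+1; apply/asboolP => e _ lt_n.
by have := leq_trans lt_n (delta0_le_card e); rewrite card_ord ltnn.
Qed.

Definition gmin (n : nat) (V : finType) (h : rel V) : nat :=
  ex_minn (forces_ex h n).

Definition kappa0 (R : realType) (V : finType) (h : rel V) : R :=
  limn (fun n => (gmin n h)%:R / n%:R : R)%R.

(* Main.v *)
Require Import Defs.
From mathcomp Require Import all_boot all_order all_algebra.
From mathcomp Require Import reals.
From mathcomp Require Import boolp classical_sets topology normedtype sequences.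
From mathcomp Require Import zify ring lra.
Set Implicit Arguments.
Unset Strict Implicit.
Unset Printing Implicit Defensive.
Import Order.TTheory GRing.Theory Num.Theory.
Import numFieldNormedType.Exports.
Local Open Scope nat_scope.

(* The extremal graphs are balanced blow-ups.  For C_l^2 the base graph is the
   lexicographic product C_3[C_3]: along a homomorphic image of C_l^2 the outer
   coordinate increases at exactly one of any two consecutive steps, because
   C_3 has no transitive triangle, so l is even and l/2 is divisible by 3.  For
   P_l^2 it is a 3-regular oriented graph on 8 vertices, found by computer
   search, admitting no homomorphism from P_7^2.

   kappa0 is a limit, which must be shown to exist.  If G is an H-free graph on
   n vertices with minimum semidegree d, draw m vertices of G independently with
   m^2 <= n.  By a second moment estimate the expected number of drawn vertices
   which repeat another one, or have in the sample a degree below m d/n - t, is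
   bounded in terms of m/t; deleting those leaves an H-free graph.  Hence
   g(n,H)/n <= g(s,H)/s + o(1) as s and then n tend to infinity, which gives
   limsup <= liminf. *)

(** * Blow-ups *)

Lemma card_set_ord n (Q : pred nat) :
  #|[set y : 'I_n | Q y]| = count Q (iota 0 n).
Proof. by rewrite cardsE cardE size_filter -val_enum_ord count_map enumT. Qed.

Lemma count_iota_mod p k (P : pred nat) :
  count (fun y => P (y %% p)) (iota 0 (k * p)) = k * count P (iota 0 p).
Proof.
elim: k => // k IHk; rewrite mulSn iotaD count_cat add0n mulSn; congr (_ + _).
  by apply: eq_in_count => y; rewrite mem_iota => /andP[_ lt_yp] /=; rewrite modn_small.
rewrite -IHk -[X in iota X _]addn0 iotaDl count_map.
by apply: eq_count => y /=; rewrite modnDl.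
Qed.

Lemma ord_mul_gt0 p k : 'I_(k * p) -> 0 < p.
Proof.
move=> x; have := leq_ltn_trans (leq0n x) (ltn_ord x).
by rewrite muln_gt0 => /andP[].
Qed.

Definition blowup p k (B : rel nat) : rel 'I_(k * p) :=
  [rel x y : 'I_(k * p) | B (x %% p) (y %% p)].
Arguments blowup : clear implicits.

(** The case [x = y] excludes loops, so one test covers both clauses of [oriented]. *)
Definition table_oriented p (B : rel nat) : bool :=
  all (fun x => all (fun y => ~~ (B x y && B y x)) (iota 0 p)) (iota 0 p).

Lemma oriented_blowup p k (B : rel nat) :
  table_oriented p B -> oriented (blowup p k B).
Proof.
move=> /allP ok; have anti (x y : 'I_(k * p)) : ~~ (blowup p k B x y && blowup p k B y x).
  have p_gt0 := ord_mul_gt0 x.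
  have := ok (x %% p); rewrite mem_iota ltn_mod => /(_ p_gt0)/allP/(_ (y %% p)).
  by rewrite mem_iota ltn_mod; apply.
by split=> // x; have := anti x x; rewrite andbb; apply: negbTE.
Qed.

Definition table_regular p (d : nat) (B : rel nat) : bool :=
  all (fun x => (count (B^~ x) (iota 0 p) == d) && (count (B x) (iota 0 p) == d))
    (iota 0 p).

Lemma regular_blowup p k d (B : rel nat) :
  table_regular p d B -> regular (k * d) (blowup p k B).
Proof.
move=> /allP ok x.
have p_gt0 := ord_mul_gt0 x.
have := ok (x %% p); rewrite mem_iota ltn_mod => /(_ p_gt0)/andP[/eqP in_d /eqP out_d].
rewrite /indeg /outdeg.
rewrite (card_set_ord _ (fun y => B (y %% p) (x %% p))).
rewrite (card_set_ord _ (fun y => B (x %% p) (y %% p))).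
rewrite (count_iota_mod _ _ (B^~ (x %% p))) (count_iota_mod _ _ (B (x %% p))).
by rewrite in_d out_d.
Qed.

(** * The two base graphs *)

(** The number [3 * a + b] encodes the vertex with outer coordinate a and inner coordinate b. *)
Definition C3C3 : rel nat := [rel x y |
  (y %/ 3 == (x %/ 3).+1 %% 3) || (y %/ 3 == x %/ 3) && (y %% 3 == (x %% 3).+1 %% 3)].

(** If neither step moved the outer coordinate, the inner ones would form a transitive triangle in
    C_3; if both did, [z] would lie two classes ahead of [x], not one. The proof runs through all
    triples. *)
Lemma C3C3_square_step x y z : x < 9 -> y < 9 -> z < 9 ->
    C3C3 x y -> C3C3 y z -> C3C3 x z ->
  (z %/ 3 == (x %/ 3).+1 %% 3) /\ (z %/ 3 == y %/ 3) = ~~ (y %/ 3 == x %/ 3).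
Proof.
do 9?[case: x => [|x]] => //; do 9?[case: y => [|y]] => //;
  do 9?[case: z => [|z]] => //.
Qed.

Lemma square_dicycle l (x : 'I_l) (y : 'I_l) j :
  0 < j <= 2 -> 2 < l -> y = (x + j) %% l :> nat -> square (@dicycle l) x y.
Proof.
move=> j_bd l_gt2 def_y; have lt_xl := ltn_ord x; apply/andP; split.
  apply/eqP => /(congr1 val) /= eq_xy.
  have := eqn_modDl x j 0 l; rewrite addn0 -def_y -eq_xy (modn_small lt_xl) eqxx.
  by rewrite mod0n modn_small; lia.
case: j j_bd def_y => [|[|[|]]] // _ def_y; apply/orP.
  by left; apply/eqP/val_inj; rewrite /= def_y addn1.
right; apply/existsP; exists (ordS x); rewrite /dicycle /= eqxx.
by apply/eqP/val_inj; rewrite /= def_y -[(_ %% l).+1]addn1 modnDml addn1 addn2.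
Qed.

Lemma C3C3_blowup_square_dicycle k l : 2 < l -> l != 0 %[mod 6] ->
  ~ contains_copy (blowup 9 k C3C3) (square (@dicycle l)).
Proof.
move=> l_gt2 l_mod6 [f _ hom_f].
have l_gt0 : 0 < l by lia.
(* Reading indices modulo [l] turns the copy into a periodic walk in the base graph, indexed by all
   naturals. *)
pose w i : nat := f (Ordinal (ltn_pmod i l_gt0)) %% 9.
have w_lt i : w i < 9 by rewrite ltn_mod.
have wE i j : 0 < j <= 2 -> C3C3 (w i) (w (i + j)).
  move=> j_bd; apply: (hom_f); apply: (square_dicycle j_bd) => //=.
  by rewrite modnDml.
have w_per i : w (i + l) = w i.
  by rewrite /w; congr (f _ %% 9); apply: val_inj; rewrite /= modnDr.
have step i := C3C3_square_step (w_lt i) (w_lt (i + 1)) (w_lt (i + 2))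
  (wE i 1 isT) (eq_ind _ (fun j => C3C3 _ (w j)) (wE (i + 1) 1 isT) _ (esym (addnA i 1 1))) (wE i 2 isT).
(* [s i] marks the steps inside one outer class; by [step] they alternate with the others. *)
pose s i := w (i + 1) %/ 3 == w i %/ 3.
have s_odd i : s i = odd i (+) s 0.
  elim: i => [|i IHi]; first by [].
  rewrite /= addNb -IHi; have [_] := step i; rewrite /s.
  by rewrite -[i.+1]addn1 -addnA => ->.
have a_half i : w (2 * i) %/ 3 = (w 0 %/ 3 + i) %% 3.
  elim: i => [|i IHi]; first by rewrite muln0; move: (w 0) (w_lt 0) => a; lia.
  have [/eqP] := step (2 * i); rewrite mulnS addnC => -> _; rewrite IHi.
  by move: (w 0 %/ 3) => a; lia.
have even_l : ~~ odd l.
  have := s_odd l; rewrite /s addnC w_per -[l]add0n w_per.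
  by case: (odd _) => //; rewrite -/(s 0); case: (s 0).
(* Going around the cycle twice avoids halving [l]: the [2 * l] steps raise the outer coordinate by
   [l] modulo 3 and return to the start, so 3 divides [l]. With [even_l] this gives 6. *)
have := a_half l; rewrite mul2n -addnn w_per -[X in w X]add0n w_per.
move: (w 0) (w_lt 0) l_mod6 even_l => a; lia.
Qed.

(* Row x lists the out-neighbours of x. *)
Definition P7free8 : rel nat := [rel x y |
  y \in nth [::] [:: [:: 2; 3; 4]; [:: 2; 4; 6]; [:: 4; 5; 7]; [:: 1; 6; 7];
                     [:: 3; 6; 7]; [:: 0; 1; 3]; [:: 0; 2; 5]; [:: 0; 1; 5]] x].

(** Exhaustive search, decidable by computation: [true] certifies that a walk ending in [x], [y] has
    no extension by [k] vertices, each dominated by both of its predecessors. *)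
Fixpoint no_square_walk (B : rel nat) p k x y : bool :=
  if k is k'.+1 then
    all (fun z => B x z && B y z ==> no_square_walk B p k' y z) (iota 0 p)
  else false.

Lemma no_square_walkP (B : rel nat) p k i (w : nat -> nat) :
    no_square_walk B p k (w i) (w i.+1) -> (forall j, w j < p) ->
    (forall j, j < i + k -> B (w j) (w j.+2) && B (w j.+1) (w j.+2)) -> False.
Proof.
elim: k i => // k IHk i /= /allP no_walk w_lt wB.
have := no_walk (w i.+2); rewrite mem_iota w_lt wB ?addnS ?ltnS ?leq_addr //.
move=> /(_ isT) /IHk; apply=> // j lt_j; apply: wB; lia.
Qed.

Lemma P7free8_blowup_square_dipath k l : 7 <= l ->
  ~ contains_copy (blowup 8 k P7free8) (square (@dipath l)).
Proof.
move=> l_ge7 [f _ hom_f].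
have l_gt0 : 0 < l by lia.
pose w i : nat := f (Ordinal (ltn_pmod i l_gt0)) %% 8.
have w_lt i : w i < 8 by rewrite ltn_mod.
have wB1 i : i < 6 -> P7free8 (w i) (w i.+1).
  move=> lt_i; apply: (hom_f); apply/andP; split.
    by apply/eqP => /(congr1 val); rewrite /= !modn_small; lia.
  by apply/orP; left; rewrite /dipath /= !modn_small; lia.
have wB2 i : i < 5 -> P7free8 (w i) (w i.+2).
  move=> lt_i; apply: (hom_f); apply/andP; split.
    by apply/eqP => /(congr1 val); rewrite /= !modn_small; lia.
  apply/orP; right; apply/existsP; exists (Ordinal (ltn_pmod i.+1 l_gt0)).
  by rewrite /dipath /= !modn_small; lia.
(* The edge from [w 0] to [w 1] is given; 5 more vertices complete the 7 of P_7^2. *)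
apply: (@no_square_walkP P7free8 8 5 0 w) => //; last first.
  by move=> j lt_j; rewrite wB1 ?wB2; lia.
have ok : all (fun x => all (fun y => P7free8 x y ==> no_square_walk P7free8 8 5 x y)
                 (iota 0 8)) (iota 0 8) by vm_compute.
move/allP: ok => /(_ (w 0)); rewrite mem_iota w_lt => /(_ isT) /allP /(_ (w 1)).
by rewrite mem_iota w_lt wB1 // => /(_ isT).
Qed.

(** * Sampling *)

(** A minimum is one of its arguments, and the default [#|T|] counts among them. *)
Lemma delta0_ind (T : finType) (e : rel T) (P : nat -> Prop) :
  P #|T| -> (forall x, P (indeg e x)) -> (forall x, P (outdeg e x)) -> P (delta0 e).
Proof.
move=> PT Pin Pout; rewrite /delta0; elim/big_ind: _ => // [m n Pm Pn|x _].
  by rewrite minnE; case: (leqP m n) => le; [rewrite (eqP le) subn0 | rewrite subKn // ltnW].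
by case: (leqP (indeg e x) (outdeg e x)).
Qed.

Lemma delta0_le_mindeg (T : finType) (e : rel T) x :
  delta0 e <= minn (indeg e x) (outdeg e x).
Proof.
rewrite /delta0; have := mem_index_enum x; elim: (index_enum T) => // y r IHr.
rewrite inE big_cons => /predU1P[<-|/IHr]; first exact: geq_minl.
by apply: leq_trans; exact: geq_minr.
Qed.

Lemma gmin_le (V : finType) (h : rel V) n : gmin n h <= n.+1.
Proof.
rewrite /gmin; case: ex_minnP => m _; apply; apply/asboolP => e _ lt_n.
by have := leq_trans lt_n (delta0_le_card e); rewrite card_ord ltnn.
Qed.

Lemma delta0_lt_gmin (V : finType) (h : rel V) n (e : rel 'I_n) :
  oriented e -> ~ contains_copy e h -> delta0 e < gmin n h.
Proof.
move=> or_e free_e; rewrite ltnNge; apply/negP; rewrite /gmin.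
by case: ex_minnP => m /asboolP force_m _ /(force_m e or_e).
Qed.

(** By minimality the predecessor of [gmin n h] does not force [h]; a counterexample to it is the
    graph sought. *)
Lemma gmin_extremal (V : finType) (h : rel V) n : 0 < gmin n h ->
  exists e : rel 'I_n, [/\ oriented e, ~ contains_copy e h & gmin n h <= (delta0 e).+1].
Proof.
rewrite /gmin; case: ex_minnP => [[|m] // _ min_m _].
have : ~ forces h n m by move=> /asboolP /min_m; rewrite ltnn.
move=> /existsNP[e] /not_implyP[or_e] /not_implyP[le_m free_e].
by exists e.
Qed.

Local Open Scope ring_scope.

Section Sampling.
Variables (I T : finType).
Implicit Types (phi : {ffun I -> T}) (k : I).

Definition ffun_set k (u : T) phi : {ffun I -> T} :=
  [ffun i => if i == k then u else phi i].

(** Redrawing the value at [k] preserves the uniform distribution: exchanging [phi k] and [u] is an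
    involution on pairs. *)
Lemma sum_ffun_set k (G : {ffun I -> T} -> int) :
  \sum_phi \sum_u G (ffun_set k u phi) = (\sum_phi G phi) * #|T|%:Z.
Proof.
pose sw (q : {ffun I -> T} * T) := (ffun_set k q.2 q.1, q.1 k).
have swK : involutive sw.
  case=> phi u; rewrite /sw /= !ffunE eqxx; congr (_, _).
  by apply/ffunP => i; rewrite !ffunE; case: eqP => // ->.
transitivity (\sum_phi \sum_(u : T) G phi).
  by rewrite !pair_bigA [RHS](reindex_inj (inv_inj swK)).
rewrite mulr_suml; apply: eq_bigr => phi _.
by rewrite sumr_const -mulr_natr natz.
Qed.

Lemma sum_ffun_coincide i k : i != k ->
  (\sum_(phi : {ffun I -> T}) (phi i == phi k)%:Z) * #|T|%:Z = #|{ffun I -> T}|%:Z.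
Proof.
move=> neq_ik; rewrite -(sum_ffun_set k) -[RHS]natz -sumr_const.
apply: eq_bigr => phi _; rewrite (bigD1 (phi i)) //= !ffunE eqxx (negPf neq_ik).
rewrite eqxx big1 ?addr0 // => u neq_u; rewrite !ffunE eqxx (negPf neq_ik).
by rewrite eq_sym (negPf neq_u).
Qed.

Variable y : T -> T -> int.
Hypothesis y_sum0 : forall v, \sum_u y v u = 0.

(** At least one of [j], [k] differs from [i]. Redrawing that one leaves the other factor fixed and
    averages its own factor to 0 by [y_sum0]. *)
Lemma sum_ffun_uncorrelated i j k : j != k ->
  \sum_(phi : {ffun I -> T}) y (phi i) (phi j) * y (phi i) (phi k) = 0.
Proof.
wlog neq_ik : j k / i != k.
  move=> ortho; have [eq_ik|neq_ik] := eqVneq i k; last exact: ortho.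
  rewrite eq_sym -eq_ik => neq_ij; rewrite -[RHS](ortho i j neq_ij neq_ij).
  by apply: eq_bigr => phi _; rewrite mulrC.
move=> neq_jk; have [T0|T_gt0] := posnP #|T|.
  by rewrite big1 // => phi _; have := card0_eq T0 (phi i); rewrite inE.
apply: (@mulIf _ #|T|%:Z); first by rewrite eqz_nat -lt0n.
rewrite mul0r -(sum_ffun_set k); apply: big1 => phi _.
under eq_bigr => u _ do
  rewrite !ffunE eqxx (negPf neq_jk) (negPf neq_ik).
by rewrite -mulr_sumr y_sum0 mulr0.
Qed.

(** In the expanded square only the [#|I|] diagonal terms survive, each at most [c ^+ 2]. *)
Lemma sum_ffun_second_moment i (c : int) : (forall v u, `|y v u| <= c) ->
  \sum_(phi : {ffun I -> T}) (\sum_j y (phi i) (phi j)) ^+ 2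
    <= #|I|%:Z * c ^+ 2 * #|{ffun I -> T}|%:Z.
Proof.
move=> y_le.
under eq_bigr => phi _ do rewrite expr2 big_distrlr /=.
rewrite exchange_big /= -mulrA mulrC -[X in _ * X]natz -sumr_const mulr_sumr.
apply: ler_sum => j _; rewrite mulr1 exchange_big (bigD1 j) //= [X in _ + X]big1 ?addr0.
  rewrite mulrC -[X in _ <= X * _]natz -sumr_const mulr_suml; apply: ler_sum => phi _.
  rewrite mul1r -expr2 -[X in X <= _]real_normK ?num_real //.
  by rewrite lerXn2r ?nnegrE // (le_trans _ (y_le (phi i) (phi j))).
by move=> k neq_kj; apply: sum_ffun_uncorrelated; rewrite eq_sym.
Qed.

End Sampling.

(** Degree in the sample minus its proportional share of the full degree, multiplied by [#|T|] to
    stay in the integers. *)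
Definition deviation (I T : finType) (r : rel T) (phi : {ffun I -> T}) (i : I) : int :=
  #|T|%:Z * #|[set j | r (phi i) (phi j)]|%:Z
  - #|I|%:Z * #|[set u | r (phi i) u]|%:Z.

Lemma sum_natz_card (I : finType) (P : pred I) :
  \sum_i (P i)%:Z = #|[set i | P i]|%:Z.
Proof.
rewrite -[RHS]natz -sumr_const big_mkcond [RHS]big_mkcond /=.
by apply: eq_bigr => i _; rewrite inE; case: (P i).
Qed.

Lemma sum_deviation (I T : finType) (r : rel T) (i : I) :
  \sum_(phi : {ffun I -> T}) deviation r phi i ^+ 2
    <= #|I|%:Z * #|T|%:Z ^+ 2 * #|{ffun I -> T}|%:Z.
Proof.
(* The indicator of [r v u], scaled by [#|T|] and centred at its mean over [u]. *)
pose y v u : int := #|T|%:Z * (r v u)%:Z - #|[set w | r v w]|%:Z.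
have y_sum0 v : \sum_u y v u = 0.
  rewrite /y sumrB -mulr_sumr sum_natz_card sumr_const -mulr_natl natz.
  exact: subrr.
have y_le v u : `|y v u| <= #|T|%:Z.
  by rewrite /y; have := max_card [set w | r v w]; case: (r v u); lia.
have := sum_ffun_second_moment y_sum0 i y_le.
congr (_ <= _); apply: eq_bigr => phi _; congr (_ ^+ 2).
rewrite /y sumrB -mulr_sumr sum_natz_card sumr_const -mulr_natl natz.
by [].
Qed.

Lemma exists_le_average (X : finType) (F : X -> int) (K : int) :
  (0 < #|X|)%N -> \sum_x F x <= K * #|X|%:Z -> exists x, F x <= K.
Proof.
move=> X_gt0 le_FK; apply/existsP; apply: contraTT le_FK.
rewrite negb_exists -ltNge => /forallP lt_K.
have [x0 _] := card_gt0P X_gt0.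
rewrite -[#|X|%:Z]natz -sumr_const mulr_sumr; apply: ltr_sum.
  by apply/hasP; exists x0; rewrite ?mem_index_enum.
by move=> x _; rewrite mulr1 ltNge lt_K.
Qed.

(* The cost of an index is at least (t |T|)^2 when the index is bad, so a map
   whose total cost is at most the average has few bad indices. *)
Lemma exists_good_sample (I T : finType) (r1 r2 : rel T) (t b : nat) :
    (0 < t)%N -> (0 < #|T|)%N -> (#|I| ^ 2 <= #|T|)%N ->
    (2 * #|I| ^ 2 + t ^ 2 <= b * t ^ 2)%N ->
  exists (phi : {ffun I -> T}) (S : {set I}),
    [/\ (#|~: S| <= b)%N, {in S &, injective phi},
        forall i, i \in S -> (#|I| * #|[set u | r1 (phi i) u]|
           <= #|T| * (#|[set j | r1 (phi i) (phi j)]| + t))%N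
      & forall i, i \in S -> (#|I| * #|[set u | r2 (phi i) u]|
           <= #|T| * (#|[set j | r2 (phi i) (phi j)]| + t))%N].
Proof.
move=> t_gt0 T_gt0 le_IT le_b; set m := #|I| in le_IT le_b *; set n := #|T| in T_gt0 le_IT *.
pose coll (phi : {ffun I -> T}) i : int := \sum_(k | i != k) (phi i == phi k)%:Z.
pose cost phi i : int := deviation r1 phi i ^+ 2 + deviation r2 phi i ^+ 2
  + (t * n)%:Z ^+ 2 * coll phi i.
have N_gt0 : (0 < #|{ffun I -> T}|)%N by rewrite card_ffun expn_gt0 T_gt0.
have sum_coll i : (\sum_phi coll phi i) * n%:Z <= m%:Z * #|{ffun I -> T}|%:Z.
  rewrite exchange_big /= mulr_suml.
  under eq_bigr => k neq_ik do rewrite sum_ffun_coincide //.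
  rewrite sumr_const -mulr_natl natz ler_wpM2r // lez_nat.
  exact: max_card.
have [phi le_phi] : exists phi, \sum_i cost phi i <= n%:Z ^+ 2 * (2 * m ^ 2 + t ^ 2)%:Z.
  apply: exists_le_average => //; rewrite exchange_big /=.
  have le_i i : \sum_phi cost phi i <= (2 * (m%:Z * n%:Z ^+ 2) + t%:Z ^+ 2 * n%:Z * m%:Z)
                  * #|{ffun I -> T}|%:Z.
    rewrite 2!big_split /= -mulr_sumr.
    have le_D1 := sum_deviation r1 i; have le_D2 := sum_deviation r2 i.
    have le_C : t%:Z ^+ 2 * n%:Z * ((\sum_phi coll phi i) * n%:Z)
        <= t%:Z ^+ 2 * n%:Z * (m%:Z * #|{ffun I -> T}|%:Z).
      by rewrite ler_wpM2l.
    rewrite PoszM exprMn; move: (\sum_phi coll phi i) le_C le_D1 le_D2 => C.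
    lra.
  apply: le_trans (ler_sum _ (fun i _ => le_i i)) _.
  have sum_cst (K : int) : \sum_(i : I) K = m%:Z * K.
    by rewrite sumr_const -mulr_natl natz.
  rewrite sum_cst [X in X <= _]mulrA ler_wpM2r //.
  (* Here [m ^ 2 <= n] keeps the collision cost, averaged over all maps, below [(t * n) ^ 2]. *)
  have : t%:Z ^+ 2 * n%:Z * (m ^ 2)%:Z <= t%:Z ^+ 2 * n%:Z * n%:Z.
    by rewrite ler_wpM2l.
  lia.
have coll_ge0 i : 0 <= coll phi i by apply: sumr_ge0.
have cost_ge0 i : 0 <= cost phi i.
  by rewrite !addr_ge0 ?sqr_ge0 // mulr_ge0 ?sqr_ge0.
have tn_gt0 : 0 < (t * n)%:Z :> int by rewrite ltz_nat muln_gt0 t_gt0.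
pose S := [set i | cost phi i < (t * n)%:Z ^+ 2].
have dev_ge i : i \in S -> (- (t * n)%:Z < deviation r1 phi i) /\ (- (t * n)%:Z < deviation r2 phi i).
  rewrite inE /cost => lt_i.
  have : 0 <= (t * n)%:Z ^+ 2 * coll phi i by rewrite mulr_ge0 ?sqr_ge0.
  have := sqr_ge0 (deviation r1 phi i); have := sqr_ge0 (deviation r2 phi i).
  by split; rewrite ltNge; apply/negP; nia.
exists phi, S; split.
- have : (t * n)%:Z ^+ 2 * #|~: S|%:Z <= \sum_i cost phi i.
    rewrite (bigID [in S]) /= ler_wpDl ?sumr_ge0 //.
    rewrite -[#|~: S|%:Z]natz -sumr_const mulr_sumr.
    under [in leRHS]eq_bigl => i do rewrite -finset.in_setC.
    by apply: ler_sum => i; rewrite !inE mulr1 -leNgt.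
  move=> /le_trans/(_ le_phi).
  have : (n ^ 2 * (2 * m ^ 2 + t ^ 2) <= n ^ 2 * (b * t ^ 2))%N by rewrite leq_mul2l le_b orbT.
  have tn2_gt0 : (0 < (t * n) ^ 2)%N by rewrite expn_gt0 muln_gt0 t_gt0 T_gt0.
  move=> le1 le2; rewrite -(leq_pmul2l tn2_gt0).
  by move: le1 le2; lia.
- move=> i k Si _ eq_phi; apply/eqP; apply: contraT => neq_ik.
  have coll_ge1 : 1 <= coll phi i.
    by rewrite /coll (bigD1 k) //= eq_phi eqxx ler_wpDr ?sumr_ge0.
  move: Si; rewrite inE /cost => lt_i.
  have := sqr_ge0 (deviation r1 phi i); have := sqr_ge0 (deviation r2 phi i).
  have : (t * n)%:Z ^+ 2 * 1 <= (t * n)%:Z ^+ 2 * coll phi i by rewrite ler_wpM2l ?sqr_ge0.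
  lia.
- by move=> i /dev_ge[+ _]; rewrite /deviation -/m -/n; lia.
- by move=> i /dev_ge[_]; rewrite /deviation -/m -/n; lia.
Qed.

Local Close Scope ring_scope.

Lemma exists_injection_into (T : finType) (S : {set T}) s : s <= #|S| ->
  exists2 sigma : 'I_s -> T, injective sigma & forall i, sigma i \in S.
Proof.
move=> le_sS; exists (fun i => enum_val (widen_ord le_sS i)); last by move=> i; exact: enum_valP.
by move=> i j /enum_val_inj/(congr1 val)/= /val_inj.
Qed.

(** Inclusion-exclusion for [P] and the image of [sigma]: at most the points outside the image are
    lost. *)
Lemma card_le_preim_inj (I T : finType) (sigma : I -> T) (P : pred T) :
    injective sigma ->
  #|[set j | P j]| + #|I| <= #|[set i | P (sigma i)]| + #|T|.
Proof.
move=> sigma_inj; pose A := [set j | P j]; pose B := sigma @: [set: I].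
have <- : #|B| = #|I| by rewrite card_imset // cardsT.
have <- : #|A :&: B| = #|[set i | P (sigma i)]|.
  rewrite -(card_imset _ sigma_inj); apply: eq_card => j; rewrite !inE.
  apply/andP/imsetP => [[Pj /imsetP[i _ def_j]]|[i]].
    by exists i; rewrite // inE -def_j.
  by rewrite inE => Pi ->; split=> //; apply: imset_f.
by rewrite -cardsUI addnC leq_add2l max_card.
Qed.

(** Draw [s + b] vertices of an extremal graph and keep [s] good ones. The tolerance [t] satisfies
    [s + b <= t * q], so [b = 2 * q ^ 2 + 1] bounds the number of bad indices. The final [+ s] pays
    for [gmin n h] exceeding the semidegree by one. *)
Lemma gmin_sample (V : finType) (h : rel V) s q n :
    let b := 2 * q ^ 2 + 1 in 0 < q -> (s + b) ^ 2 <= n ->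
  s * gmin n h <= n * (gmin s h + ((s + b) %/ q).+1 + b) + s.
Proof.
move=> b q_gt0 le_n; pose t := ((s + b) %/ q).+1; rewrite -/t.
have n_gt0 : 0 < n by apply: leq_trans le_n; rewrite expn_gt0 /b; lia.
have [->|] := posnP (gmin n h); first by rewrite muln0.
move=> /gmin_extremal[e [or_e free_e le_d]].
have le_m : s + b <= t * q by rewrite ltnW // mulSn addnC -ltn_subRL; lia.
have le_b : 2 * (s + b) ^ 2 + t ^ 2 <= b * t ^ 2.
  rewrite /b mulnDl mul1n leq_add2r -mulnA leq_mul2l /= -expnMn leq_exp2r //.
  by rewrite [q * t]mulnC; exact: le_m.
(* The relation [e] controls out-degrees, its converse in-degrees. *)
have := @exists_good_sample 'I_(s + b) 'I_n e [rel x y | e y x] t b.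
rewrite !card_ord => /(_ isT n_gt0 le_n le_b)[phi [S [le_S phi_inj out_S in_S]]].
have le_sS : s <= #|S| by have := cardsC S; rewrite card_ord; lia.
have [sigma sigma_inj sigmaS] := exists_injection_into le_sS.
pose e' : rel 'I_s := [rel i j | e (phi (sigma i)) (phi (sigma j))].
have or_e' : oriented e'.
  by case: or_e => irr anti; split=> [i|i j]; [apply: irr | apply: anti].
have free_e' : ~ contains_copy e' h.
  move=> [f f_inj hom_f]; apply: free_e; exists (fun x => phi (sigma (f x))) => //.
  by move=> x y /phi_inj eq_xy; apply/f_inj/sigma_inj/eq_xy.
have lt_g := delta0_lt_gmin or_e' free_e'.
have le_delta : (s + b) * delta0 e <= n * (delta0 e' + t + b).
  (* [c] is a degree in [e], [B] the corresponding degree in the whole sample, [A] the one left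
     after deletion. *)
  have chain c A B : delta0 e <= c -> (s + b) * c <= n * (B + t) ->
      B + s <= A + (s + b) -> (s + b) * delta0 e <= n * (A + t + b).
    move=> le_c le_B le_BA; apply: leq_trans (leq_mul (leqnn _) le_c) _.
    by apply: leq_trans le_B _; rewrite leq_mul2l; apply/orP; right; lia.
  have le_dn : delta0 e <= n by rewrite -[n in _ <= n]card_ord delta0_le_card.
  apply: (delta0_ind (P := fun c => (s + b) * delta0 e <= n * (c + t + b))) => [|i|i].
  (* The default value of [delta0 e'] is [s]; in that case [delta0 e <= n] is enough. *)
  - by rewrite card_ord mulnC; apply: leq_mul => //; lia.
  - apply: chain (in_S _ (sigmaS i)) _.
      exact: leq_trans (delta0_le_mindeg e _) (geq_minl _ _).
    have := card_le_preim_inj (fun j => e (phi j) (phi (sigma i))) sigma_inj.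
    by rewrite !card_ord.
  - apply: chain (out_S _ (sigmaS i)) _.
      exact: leq_trans (delta0_le_mindeg e _) (geq_minr _ _).
    have := card_le_preim_inj (fun j => e (phi (sigma i)) (phi j)) sigma_inj.
    by rewrite !card_ord.
apply: leq_trans (leq_mul (leqnn s) le_d) _; rewrite mulnS addnC leq_add2r.
apply: leq_trans (leq_trans le_delta _); first by rewrite leq_mul2r leq_addr orbT.
by rewrite leq_mul2l !leq_add2r ltnW ?orbT.
Qed.

(** * Existence of the limit *)

Local Open Scope ring_scope.

(** The second hypothesis puts the upper limit below every late term plus [eps], which yields
    convergence; the third puts [c] below every eventual upper bound. *)
Lemma limn_ge_of_almost_lower_bounds (R : realType) (u : nat -> R) (K c : R) :
    (forall n, 0 <= u n <= K) ->
    (forall eps, 0 < eps -> exists M, forall s, (M <= s)%N ->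
       exists N, forall n, (N <= n)%N -> u n <= u s + eps) ->
    (forall N, exists2 n, (N <= n)%N & c <= u n) ->
  c <= limn u.
Proof.
move=> u_bd u_dec c_freq.
(* E consists of the eventual upper bounds, so [inf E] is the upper limit of [u]. *)
pose E : set R := [set y | exists N, forall n, (N <= n)%N -> u n <= y]%classic.
have E_K : E K by exists 0%N => n _; have /andP[] := u_bd n.
have E0 : nonempty E by exists K.
have E_lb : has_lbound E.
  by exists 0 => y [N le_y]; apply: le_trans (le_y N _) => //; have /andP[] := u_bd N.
have cvg_u : (u @ \oo --> inf E)%classic.
  apply/cvgrPdist_le => eps eps_gt0.
  have [y [N le_y] lt_y] : exists2 y, E y & y < inf E + eps by apply: inf_adherent.
  have [M u_dec_M] := u_dec _ eps_gt0.
  exists (maxn N M) => // n /=; rewrite geq_max => /andP[le_Nn le_Mn].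
  have [N' le_n] := u_dec_M n le_Mn.
  have : inf E <= u n + eps by apply: ge_inf => //; exists N'.
  have := le_y n le_Nn.
  by move=> le1 le2; rewrite ler_distl; apply/andP; split; lra.
rewrite (cvg_lim _ cvg_u) //; apply: lb_le_inf => // y [N le_y].
by have [n le_Nn le_cu] := c_freq N; apply: le_trans le_cu (le_y n le_Nn).
Qed.

Lemma kappa0_ge (R : realType) (V : finType) (h : rel V) (c : R) :
    (forall N, exists2 n, (N <= n)%N & c <= (gmin n h)%:R / n%:R) -> c <= kappa0 R h.
Proof.
move=> c_freq; rewrite /kappa0.
(* The bound 2 comes from [n + 1 <= 2 * n] for positive [n]; at [n = 0] the quotient is 0. *)
apply: (@limn_ge_of_almost_lower_bounds _ _ 2) => // [n|eps eps_gt0].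
  rewrite divr_ge0 //=; case: n => [|n]; first by rewrite invr0 mulr0.
  rewrite ler_pdivrMr ?ltr0n // -natrM ler_nat.
  by apply: leq_trans (gmin_le h _) _; lia.
pose q := (Num.truncn (3 / eps)).+1.
have q_gt0 : 0 < q%:R :> R by rewrite ltr0n.
have lt_q : 3 / eps < q%:R by rewrite truncnS_gt.
pose b := (2 * q ^ 2 + 1)%N.
(* The bound on [s] gives [b + q + b * q <= s]; the summand [q] in the bound on [n] gives
   [s * q <= n * s]. *)
exists (q * (2 * b + 1))%N => s le_s; exists ((s + b) ^ 2 + q)%N => n le_n.
have s_gt0 : 0 < s%:R :> R by rewrite ltr0n; lia.
have n_gt0 : 0 < n%:R :> R by rewrite ltr0n; lia.
(* Of the error [3 * s], two parts come from [t * q + b * q <= 2 * s] and one from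
   [s * q <= n * s]. *)
have bound : (s * (gmin n h * q) <= n * (gmin s h * q + 3 * s))%N.
  have : ((s + b) ^ 2 <= n)%N by apply: leq_trans le_n; apply: leq_addr.
  move=> /(gmin_sample h (isT : 0 < q)%N); rewrite -/b; set t := _.+1.
  have le_t : (t * q <= s + b + q)%N by rewrite mulSn addnC leq_add2r leq_divM.
  have le_bs : (b + q + b * q <= s)%N by nia.
  have le_sq : (s * q <= n * s)%N by rewrite mulnC leq_mul2r; apply/orP; right; lia.
  have : (n * (t * q + b * q) <= n * (2 * s))%N by rewrite leq_mul2l; apply/orP; right; lia.
  move=> le1 /(leq_mul (leqnn q)).
  move: le1 le_sq; clear; nia.
have : (gmin n h)%:R / n%:R <= (gmin s h)%:R / s%:R + 3 / q%:R :> R.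
  rewrite -(ler_pM2r (mulr_gt0 s_gt0 (mulr_gt0 n_gt0 q_gt0))).
  move: bound; rewrite -(ler_nat R) !(natrM, natrD).
  set A := (gmin n h)%:R; set B := (gmin s h)%:R => bound.
  have -> : A / n%:R * (s%:R * (n%:R * q%:R)) = s%:R * (A * q%:R) by field; lra.
  have -> : (B / s%:R + 3 / q%:R) * (s%:R * (n%:R * q%:R)) =
            n%:R * (B * q%:R + 3 * s%:R) by field; lra.
  by [].
move=> /le_trans; apply; rewrite lerD2l ler_pdivrMr // mulrC -ler_pdivrMr //.
exact: ltW.
Qed.

Local Close Scope ring_scope.

(** * From regular families to lower bounds *)

Lemma regular_le_delta0 n d (e : rel 'I_n) : 0 < n -> regular d e -> d <= delta0 e.
Proof.
case: n e => // n e _ reg_e; apply: (delta0_ind (P := leq d)) => [|x|x].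
- by have [_ <-] := reg_e ord0; apply: max_card.
- by have [-> _] := reg_e x.
- by have [_ ->] := reg_e x.
Qed.

Definition regular_free_family (V : finType) (h : rel V) (a b : nat) : Prop :=
  forall N : nat, exists2 n : nat, N <= n &
    exists (d : nat) (e : rel 'I_n),
      [/\ b * d = a * n, oriented e, regular d e & ~ contains_copy e h].

Lemma regular_free_blowup (V : finType) (h : rel V) p d (B : rel nat) :
    0 < p -> table_oriented p B -> table_regular p d B ->
    (forall k, ~ contains_copy (blowup p k B) h) ->
  regular_free_family h d p.
Proof.
move=> p_gt0 or_B reg_B free_B N; exists (N * p); first by rewrite leq_pmulr.
exists (N * d), (blowup p N B); split=> //; first by rewrite mulnCA mulnA mulnC mulnA.
  exact: oriented_blowup.
exact: regular_blowup.
Qed.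

Lemma kappa0_ge_regular (R : realType) (V : finType) (h : rel V) (a b : nat) :
  0 < b -> regular_free_family h a b -> (a%:R / b%:R <= kappa0 R h)%R.
Proof.
move=> b_gt0 family; apply: kappa0_ge => N.
(* Asking for [N.+1] makes [n] positive, so that the division by [n] is meaningful. *)
have [n lt_Nn [d [e [eq_bd or_e reg_e free_e]]]] := family N.+1.
have n_gt0 : 0 < n by apply: leq_trans lt_Nn.
exists n; first exact: ltnW.
rewrite ler_pdivrMr ?ltr0n // mulrAC ler_pdivlMr ?ltr0n // -!natrM ler_nat.
rewrite -eq_bd mulnC leq_mul2r; apply/orP; right.
apply: leq_trans (regular_le_delta0 n_gt0 reg_e) _.
exact: ltnW (delta0_lt_gmin or_e free_e).
Qed.

Lemma regular_free_dicycle l : 5 <= l -> l != 0 %[mod 6] ->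
  regular_free_family (square (@dicycle l)) 4 9.
Proof.
move=> l_ge5 l_mod6; apply: (@regular_free_blowup _ _ 9 4 C3C3) => // k.
by apply: C3C3_blowup_square_dicycle => //; lia.
Qed.

Lemma regular_free_dipath l : 7 <= l ->
  regular_free_family (square (@dipath l)) 3 8.
Proof.
move=> l_ge7; apply: (@regular_free_blowup _ _ 8 3 P7free8) => // k.
exact: P7free8_blowup_square_dipath.
Qed.

Theorem proposition1p3 (R : realType) :
  ((forall l : nat, 5 <= l -> l != 0 %[mod 6] ->
      (4 / 9 <= kappa0 R (square (@dicycle l)))%R) /\
   (forall l : nat, 7 <= l ->
      (3 / 8 <= kappa0 R (square (@dipath l)))%R)) /\
  ((forall l : nat, 5 <= l -> l != 0 %[mod 6] ->
      forall N : nat, exists2 n : nat, N <= n &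
        exists (d : nat) (e : rel 'I_n),
          [/\ 9 * d = 4 * n, oriented e, regular d e &
              ~ contains_copy e (square (@dicycle l))]) /\
   (forall l : nat, 7 <= l ->
      forall N : nat, exists2 n : nat, N <= n &
        exists (d : nat) (e : rel 'I_n),
          [/\ 8 * d = 3 * n, oriented e, regular d e &
              ~ contains_copy e (square (@dipath l))])).
Proof.
split; split.
- by move=> l l_ge5 l_mod6; apply: (@kappa0_ge_regular R _ _ 4 9) => //;
    apply: regular_free_dicycle.
- by move=> l l_ge7; apply: (@kappa0_ge_regular R _ _ 3 8) => //;
    apply: regular_free_dipath.
- exact: regular_free_dicycle.
- exact: regular_free_dipath.
Qed.
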